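(* Let $t_*,x_*>0$, let $N\in\mathbb{N}$ with $N x_*\ge t_*$, and let the initial data $a_0,b_0:(0,\infty)\to\mathbb{R}$ satisfy $|b_0(x)|<a_0(x)$ for all $x>0$. The numerical scheme described in the context, which computes from $a_0,b_0$ the values $(a_{n,j},b_{n,j})$ for $n=1,\dots,2N+1$ and $j=1,\dots,M+N-\lfloor (n-1)/2\rfloor$, is stable; especially, the numerical values for the pressure $p$ always remain positive.
   Context: The scheme approximates the radially symmetric ultra-relativistic Euler equations $\partial_t(x^2a)+\partial_x(x^2b)=0$, $\partial_t(x^2b)+\partial_x(x^2c)=x(a-c)$ for $t,x>0$, where $$c=c(a,b)=\frac53a-\frac23\sqrt{4a^2-3b^2},$$ and the pressure belonging to a state $(a,b)$ with $|b|<a$ is $p=\frac13(\sqrt{4a^2-3b^2}-a)$. The word ''stable'' is used without a separate formal definition; stability is deduced from the fact that the function Euler below maps states with $|b_\pm|<a_\pm$ to a state with $|b'|<a'$. Grid. Put $\Delta t=\frac{t_*}{2N}$, $t_n=(n-1)\Delta t$ for $n=1,\dots,2N+1$, $M=\lfloor \frac{x_*}{t_*}N\rfloor\ge1$, $\Delta x=\frac{x_*}{M}$, $x_j=(j-1)\Delta x$ for $j=1,\dots,N+M+1$, and $\lambda=\frac{\Delta x}{2\Delta t}$ (so $\lambda\ge1$). The staggered gridpoints are $(t_n,x_{n,j})$, $n=1,\dots,2N+1$, $j=1,\dots,M+N-\lfloor(n-1)/2\rfloor$, with $x_{n,j}=(x_j+x_{j+1})/2$ if $n$ is odd and $x_{n,j}=x_j$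 if $n$ is even. The numerical solution at $(t_n,x_{n,j})$ is $(a_{n,j},b_{n,j})$. The function Euler. For $\overline{x}\ge0$ and states $(a_\pm,b_\pm)$ with $|b_\pm|<a_\pm$, put $c_\pm=c(a_\pm,b_\pm)$ and $$q=\frac{2\overline{x}\,\Delta x}{\overline{x}^2+\frac13(\Delta x)^2},\qquad \eta=\frac{q}{6\lambda},$$ $$a'=\frac12\Big(a_-+\frac{b_-}{\lambda}\Big)\Big(1-\frac q2\Big)+\frac12\Big(a_+-\frac{b_+}{\lambda}\Big)\Big(1+\frac q2\Big),$$ $$\xi=\frac12\Big(b_-+\frac{c_-}{\lambda}\Big)\Big(1-\frac q2\Big)+\frac12\Big(b_+-\frac{c_+}{\lambda}\Big)\Big(1+\frac q2\Big)-\frac{a'q}{6\lambda},$$ $$b'=\frac{\xi+\eta\sqrt{4a'^2(1+3\eta^2)-3\xi^2}}{1+3\eta^2}.$$ Then $\mathrm{Euler}(a_-,b_-,a_+,b_+,\overline{x},\Delta x,\lambda)=(a',b')$. The scheme. (1) Initialization: $a_{1,j}=a_0(x_{1,j})$, $b_{1,j}=b_0(x_{1,j})$ for $j=1,\dots,M+N$. (2) If $n\in\{1,\dots,2N\}$ is odd: $(a_{n+1,1},b_{n+1,1})=\mathrm{Euler}(a_{n,1},-b_{n,1},a_{n,1},b_{n,1},0,\Delta x,\lambda)$ (which gives $b_{n+1,1}=0$), and for $j=2,\dots,M+N-(n-1)/2$, $(a_{n+1,j},b_{n+1,j})=\mathrm{Euler}(a_{n,j-1},b_{n,j-1},a_{n,j},b_{n,j},x_{n+1,j},\Delta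 x,\lambda)$, where $x_{n+1,j}=x_j$. (3) If $n\in\{1,\dots,2N\}$ is even: for $j=1,\dots,M+N-n/2$, $(a_{n+1,j},b_{n+1,j})=\mathrm{Euler}(a_{n,j},b_{n,j},a_{n,j+1},b_{n,j+1},x_{n+1,j},\Delta x,\lambda)$, where $x_{n+1,j}=(x_j+x_{j+1})/2$. *)

(* Defs.v *)
From Stdlib Require Import Reals Arith.
Open Scope R_scope.

Definition state (a b : R) : Prop := Rabs b < a.

Definition flux (a b : R) : R :=
  5 / 3 * a - 2 / 3 * sqrt (4 * a ^ 2 - 3 * b ^ 2).

Definition pressure (a b : R) : R :=
  1 / 3 * (sqrt (4 * a ^ 2 - 3 * b ^ 2) - a).

Definition euler_q (xbar dx : R) : R :=
  2 * xbar * dx / (xbar ^ 2 + 1 / 3 * dx ^ 2).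

Definition euler_eta (xbar dx lambda : R) : R :=
  euler_q xbar dx / (6 * lambda).

Definition euler_a (am bm ap bp xbar dx lambda : R) : R :=
  let q := euler_q xbar dx in
  1 / 2 * (am + bm / lambda) * (1 - q / 2)
  + 1 / 2 * (ap - bp / lambda) * (1 + q / 2).

Definition euler_xi (am bm ap bp xbar dx lambda : R) : R :=
  let q := euler_q xbar dx in
  let a' := euler_a am bm ap bp xbar dx lambda in
  1 / 2 * (bm + flux am bm / lambda) * (1 - q / 2)
  + 1 / 2 * (bp - flux ap bp / lambda) * (1 + q / 2)
  - a' * q / (6 * lambda).

Definition euler_radicand (am bm ap bp xbar dx lambda : R) : R :=
  let eta := euler_eta xbar dx lambda in
  let a' := euler_a am bm ap bp xbar dx lambda in
  let xi := euler_xi am bm ap bp xbar dx lambda in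
  4 * a' ^ 2 * (1 + 3 * eta ^ 2) - 3 * xi ^ 2.

Definition euler_b (am bm ap bp xbar dx lambda : R) : R :=
  let eta := euler_eta xbar dx lambda in
  let xi := euler_xi am bm ap bp xbar dx lambda in
  (xi + eta * sqrt (euler_radicand am bm ap bp xbar dx lambda))
  / (1 + 3 * eta ^ 2).

Definition Euler (am bm ap bp xbar dx lambda : R) : R * R :=
  (euler_a am bm ap bp xbar dx lambda, euler_b am bm ap bp xbar dx lambda).

Definition time_step (ts : R) (N : nat) : R := ts / (2 * INR N).

(* [Int_part] is the floor function. *)
Definition grid_M (ts xs : R) (N : nat) : nat :=
  Z.to_nat (Int_part (xs / ts * INR N)).

Definition space_step (ts xs : R) (N : nat) : R := xs / INR (grid_M ts xs N).

Definition grid_lambda (ts xs : R) (N : nat) : R :=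
  space_step ts xs N / (2 * time_step ts N).

Definition node (ts xs : R) (N j : nat) : R :=
  (INR j - 1) * space_step ts xs N.

Definition grid_x (ts xs : R) (N n j : nat) : R :=
  if Nat.odd n then (node ts xs N j + node ts xs N (j + 1)) / 2
  else node ts xs N j.

Definition on_grid (ts xs : R) (N n j : nat) : Prop :=
  (1 <= n <= 2 * N + 1)%nat /\
  (1 <= j <= grid_M ts xs N + N - (n - 1) / 2)%nat.

(* Passes from the values [u] at time level [n] to those at level [n + 1]. *)
Definition scheme_step (ts xs : R) (N n : nat) (u : nat -> R * R) (j : nat)
    : R * R :=
  let dx := space_step ts xs N in
  let lambda := grid_lambda ts xs N in
  if Nat.odd n then
    if Nat.eqb j 1 then
      Euler (fst (u 1%nat)) (- snd (u 1%nat)) (fst (u 1%nat)) (snd (u 1%nat))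
        0 dx lambda
    else
      Euler (fst (u (j - 1)%nat)) (snd (u (j - 1)%nat)) (fst (u j)) (snd (u j))
        (grid_x ts xs N (n + 1) j) dx lambda
  else
    Euler (fst (u j)) (snd (u j)) (fst (u (j + 1)%nat)) (snd (u (j + 1)%nat))
      (grid_x ts xs N (n + 1) j) dx lambda.

(* The pair (a_{n,j}, b_{n,j}).  Time levels and space indices start at 1; the
   recursion is total, but only the values with [on_grid ts xs N n j] are part
   of the scheme, and these depend only on values that are on the grid. *)
Fixpoint scheme (ts xs : R) (N : nat) (a0 b0 : R -> R) (n : nat)
    : nat -> R * R :=
  match n with
  | O => fun _ => (0, 0)
  | S O => fun j => (a0 (grid_x ts xs N 1 j), b0 (grid_x ts xs N 1 j))
  | S (S _ as m) => scheme_step ts xs N m (scheme ts xs N a0 b0 m)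
  end.

Definition scheme_a (ts xs : R) (N : nat) (a0 b0 : R -> R) (n j : nat) : R :=
  fst (scheme ts xs N a0 b0 n j).

Definition scheme_b (ts xs : R) (N : nat) (a0 b0 : R -> R) (n j : nat) : R :=
  snd (scheme ts xs N a0 b0 n j).

(* Since [sqrt] is total, nonnegativity of the radicand is required explicitly:
   it says that the update is well defined.  The radicand [4 a^2 - 3 b^2] in
   [flux] and [pressure] is positive for every state. *)
Definition Euler_preserves_states (dx lambda : R) : Prop :=
  forall am bm ap bp xbar : R,
    0 <= xbar -> state am bm -> state ap bp ->
    0 <= euler_radicand am bm ap bp xbar dx lambda /\
    state (fst (Euler am bm ap bp xbar dx lambda))
          (snd (Euler am bm ap bp xbar dx lambda)).

Definition scheme_stable (ts xs : R) (N : nat) (a0 b0 : R -> R) : Prop :=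
  Euler_preserves_states (space_step ts xs N) (grid_lambda ts xs N) /\
  forall n j : nat, on_grid ts xs N n j ->
    state (scheme_a ts xs N a0 b0 n j) (scheme_b ts xs N a0 b0 n j).

(* Main.v *)
(** Idea: write [xi = xi0 - eta * a'].  Since [0 <= q <= sqrt 3 < 2], both
    [a' - xi0] and [a' + xi0] are combinations with positive weights of terms
    attached to the single states, which are affine in [1 / lambda] and positive
    at [1 / lambda = 0] and at [1 / lambda = 1]; hence [Rabs xi0 < a'].  The
    number [b'] solves [b' = xi + eta * sqrt (4 a'^2 - 3 b'^2)], and as
    [3 eta < 1] this turns [Rabs xi0 < a'] into [Rabs b' < a']. *)
Require Import Defs.
From Stdlib Require Import Reals ZArith Lra Lia.
Open Scope R_scope.

(** * States, flux bounds and positive pressure *)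

Lemma state_bounds (a b : R) : state a b <-> - a < b < a.
Proof.
  unfold state; split; [intros H; apply Rabs_def2 in H; lra|].
  intros [H1 H2]; apply Rabs_def1; lra.
Qed.

Lemma state_opp (a b : R) : state a b -> state a (- b).
Proof. rewrite !state_bounds; lra. Qed.

Lemma lt_sqrt_state (a b : R) : state a b -> a < sqrt (4 * a ^ 2 - 3 * b ^ 2).
Proof.
  rewrite state_bounds; intros H.
  rewrite <- (sqrt_pow2 a) at 1 by lra.
  apply sqrt_lt_1; nra.
Qed.

(** The squares of the two sides differ by [12 * (a - b)^2]. *)
Lemma sqrt_state_lt (a b : R) :
  state a b -> sqrt (4 * a ^ 2 - 3 * b ^ 2) < 4 * a - 3 * b.
Proof.
  rewrite state_bounds; intros H.
  rewrite <- (sqrt_pow2 (4 * a - 3 * b)) by lra.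
  apply sqrt_lt_1; nra.
Qed.

Lemma pressure_pos (a b : R) : state a b -> 0 < pressure a b.
Proof. intros H; apply lt_sqrt_state in H; unfold pressure; lra. Qed.

Lemma flux_opp (a b : R) : flux a (- b) = flux a b.
Proof.
  unfold flux; now replace ((- b) ^ 2) with (b ^ 2) by ring.
Qed.

Lemma flux_lt (a b : R) : state a b -> flux a b < a.
Proof. intros H; apply lt_sqrt_state in H; unfold flux; lra. Qed.

Lemma flux_gt (a b : R) : state a b -> 2 * b - a < flux a b.
Proof. intros H; apply sqrt_state_lt in H; unfold flux; lra. Qed.

(** The sum of the two entries is [(1 - l) * (a + b) + l * (a + 2 * b + flux a b)], their difference
    [(1 - l) * (a - b) + l * (a - flux a b)]. The flux bounds make the factors of [l] positive. *)
Lemma state_flux_left (a b l : R) :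
  0 <= l <= 1 -> state a b -> state (a + b * l) (b + flux a b * l).
Proof.
  intros Hl H.
  assert (H1 := flux_lt a b H).
  assert (H2 := flux_gt a (- b) (state_opp a b H)).
  rewrite flux_opp in H2.
  apply state_bounds in H; apply state_bounds; split.
  - assert (0 <= l * (a + b + (b + flux a b))) by (apply Rmult_le_pos; lra).
    (* The term with weight [l] may vanish, so strictness comes from the term with weight [1 - l],
       except at [l = 1], where the flux bound itself is strict. *)
    destruct (Req_dec l 1) as [->|]; [lra|].
    assert (0 < (1 - l) * (a + b)) by (apply Rmult_lt_0_compat; lra).
    nra.
  - assert (0 <= l * (a - flux a b)) by (apply Rmult_le_pos; lra).
    destruct (Req_dec l 1) as [->|]; [lra|].
    assert (0 < (1 - l) * (a - b)) by (apply Rmult_lt_0_compat; lra).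
    nra.
Qed.

Lemma state_flux_right (a b l : R) :
  0 <= l <= 1 -> state a b -> state (a - b * l) (b - flux a b * l).
Proof.
  intros Hl H.
  assert (H' := state_flux_left a (- b) l Hl (state_opp a b H)).
  rewrite flux_opp in H'; rewrite state_bounds in *; lra.
Qed.

Lemma state_combine (u v a1 b1 a2 b2 : R) :
  0 < u -> 0 < v -> state a1 b1 -> state a2 b2 ->
  state (a1 * u + a2 * v) (b1 * u + b2 * v).
Proof.
  rewrite !state_bounds; intros; split; nra.
Qed.

(** * One Euler update *)

Lemma euler_q_bounds (xbar dx : R) :
  0 <= xbar -> 0 < dx -> 0 <= euler_q xbar dx /\ euler_q xbar dx < 2.
Proof.
  intros Hx Hd; unfold euler_q.
  assert (0 < xbar ^ 2 + 1 / 3 * dx ^ 2) by nra.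
  split.
  - apply Rle_mult_inv_pos; [nra | assumption].
  - apply Rmult_lt_reg_r with (xbar ^ 2 + 1 / 3 * dx ^ 2); [assumption|].
    unfold Rdiv at 1; rewrite Rmult_assoc, Rinv_l by lra.
    (* This square gives [xbar * dx <= xbar^2 + dx^2 / 4], and [1 / 4 < 1 / 3]. *)
    assert (0 <= (2 * xbar - dx) ^ 2) by apply pow2_ge_0.
    nra.
Qed.

Lemma euler_eta_bounds (xbar dx lambda : R) :
  0 <= xbar -> 0 < dx -> 1 <= lambda ->
  0 <= euler_eta xbar dx lambda /\ 3 * euler_eta xbar dx lambda < 1.
Proof.
  intros Hx Hd Hl; unfold euler_eta.
  destruct (euler_q_bounds xbar dx Hx Hd) as [H0 H1].
  split.
  - apply Rle_mult_inv_pos; lra.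
  - apply Rmult_lt_reg_r with (6 * lambda); [lra|].
    replace (3 * (euler_q xbar dx / (6 * lambda)) * (6 * lambda))
      with (3 * euler_q xbar dx) by (field; lra).
    lra.
Qed.

(** Adding [eta * a'] cancels the last term of [euler_xi]; what remains is [xi0], combined with the
    same weights as [a']. *)
Lemma state_euler_xi (am bm ap bp xbar dx lambda : R) :
  0 <= xbar -> 0 < dx -> 1 <= lambda -> state am bm -> state ap bp ->
  state (euler_a am bm ap bp xbar dx lambda)
    (euler_xi am bm ap bp xbar dx lambda
     + euler_eta xbar dx lambda * euler_a am bm ap bp xbar dx lambda).
Proof.
  intros Hx Hd Hl Hm Hp.
  destruct (euler_q_bounds xbar dx Hx Hd) as [H0 H1].
  assert (Hinv : 0 <= / lambda <= 1).
  { split; [left; apply Rinv_0_lt_compat; lra|].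
    rewrite <- Rinv_1; apply Rinv_le_contravar; lra. }
  assert (H := state_combine (1 / 2 * (1 - euler_q xbar dx / 2))
                 (1 / 2 * (1 + euler_q xbar dx / 2)) _ _ _ _
                 ltac:(lra) ltac:(lra)
                 (state_flux_left am bm _ Hinv Hm)
                 (state_flux_right ap bp _ Hinv Hp)).
  unfold euler_xi, euler_eta; cbv zeta.
  set (a' := euler_a am bm ap bp xbar dx lambda).
  match type of H with state ?a ?b =>
    replace a with a' in H by (unfold a', euler_a; cbv zeta; field; lra);
    match goal with |- state _ ?b' => replace b' with b by (field; lra) end
  end.
  exact H.
Qed.

Lemma radicand_nonneg (a xi eta : R) :
  0 <= eta -> state a (xi + eta * a) ->
  0 <= 4 * a ^ 2 * (1 + 3 * eta ^ 2) - 3 * xi ^ 2.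
Proof.
  rewrite state_bounds; intros He H.
  (* The radicand splits as [a^2 (1 - 3 eta)^2 + 3 (a^2 (1 + eta)^2 - xi^2)]. *)
  assert (0 <= (a * (1 - 3 * eta)) ^ 2) by apply pow2_ge_0.
  assert (0 <= eta * a) by (apply Rmult_le_pos; lra).
  assert (0 <= (a * (1 + eta) - xi) * (a * (1 + eta) + xi))
    by (apply Rmult_le_pos; lra).
  nra.
Qed.

(** The value is the larger root of [P(t) = (t - xi)^2 - eta^2 * (4 * a^2 - 3 * t^2)], and
    [k * P(t) = (k * t - xi)^2 - (eta * r)^2]. At [t = a] and [t = - a] this gives [Upper] and
    [Lower], which locate the root relative to both points. *)
Lemma state_implicit_root (a xi eta : R) :
  0 <= eta -> 3 * eta < 1 -> state a (xi + eta * a) ->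
  state a ((xi + eta * sqrt (4 * a ^ 2 * (1 + 3 * eta ^ 2) - 3 * xi ^ 2))
           / (1 + 3 * eta ^ 2)).
Proof.
  intros He He1 H.
  assert (HD := radicand_nonneg a xi eta He H).
  apply state_bounds in H.
  set (D := 4 * a ^ 2 * (1 + 3 * eta ^ 2) - 3 * xi ^ 2) in *.
  assert (Hr := sqrt_pos D).
  assert (Hr2 := pow2_sqrt D HD).
  set (r := sqrt D) in *.
  set (k := 1 + 3 * eta ^ 2).
  assert (Hk : 1 <= k) by (unfold k; nra).
  assert (Hea : 0 <= eta * a) by (apply Rmult_le_pos; lra).
  assert (Hka : a <= a * k) by nra.
  assert (Er : 0 <= eta * r) by (apply Rmult_le_pos; lra).
  assert (Upper : (a * k - xi) ^ 2 - (eta * r) ^ 2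
                  = k * ((a - xi) ^ 2 - (eta * a) ^ 2))
    by (rewrite (Rpow_mult_distr eta r), Hr2; unfold D, k; ring).
  assert (Lower : (a * k + xi) ^ 2 - (eta * r) ^ 2
                  = k * ((a + xi) ^ 2 - (eta * a) ^ 2))
    by (rewrite (Rpow_mult_distr eta r), Hr2; unfold D, k; ring).
  apply state_bounds; split.
  - apply Rmult_lt_reg_r with k; [lra|].
    replace ((xi + eta * r) / k * k) with (xi + eta * r) by (field; lra).
    (* If [a * k + xi <= 0], then also [a + xi <= 0], so the hypothesis yields [|a + xi| < eta * a];
       by [Lower], [|a * k + xi| < eta * r]. *)
    destruct (Rlt_le_dec 0 (a * k + xi)) as [Hpos|Hneg]; [lra|].
    assert (0 < (eta * a - (a + xi)) * (eta * a + (a + xi)))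
      by (apply Rmult_lt_0_compat; lra).
    assert (0 < k * ((eta * a) ^ 2 - (a + xi) ^ 2))
      by (apply Rmult_lt_0_compat; nra).
    nra.
  - apply Rmult_lt_reg_r with k; [lra|].
    replace ((xi + eta * r) / k * k) with (xi + eta * r) by (field; lra).
    assert (0 < (a - xi - eta * a) * (a - xi + eta * a))
      by (apply Rmult_lt_0_compat; lra).
    assert (0 < k * ((a - xi) ^ 2 - (eta * a) ^ 2))
      by (apply Rmult_lt_0_compat; nra).
    nra.
Qed.

Lemma Euler_preserves_states_of_lambda (dx lambda : R) :
  0 < dx -> 1 <= lambda -> Euler_preserves_states dx lambda.
Proof.
  intros Hd Hl am bm ap bp xbar Hx Hm Hp.
  assert (H := state_euler_xi am bm ap bp xbar dx lambda Hx Hd Hl Hm Hp).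
  destruct (euler_eta_bounds xbar dx lambda Hx Hd Hl) as [He He1].
  split.
  - exact (radicand_nonneg _ _ _ He H).
  - exact (state_implicit_root _ _ _ He He1 H).
Qed.

(** * Grid geometry *)

Lemma grid_M_bounds (ts xs : R) (N : nat) :
  0 < ts -> INR N * xs >= ts ->
  1 <= INR (grid_M ts xs N) /\ INR (grid_M ts xs N) * ts <= INR N * xs.
Proof.
  intros Hts HN; unfold grid_M.
  set (y := xs / ts * INR N).
  assert (Hy : y * ts = INR N * xs) by (unfold y; field; lra).
  assert (Hy1 : 1 <= y) by nra.
  destruct (base_Int_part y) as [B1 B2].
  (* Positivity of the floor gives [M >= 1] and keeps [Z.to_nat] from truncating. *)
  assert (Hp : (0 < Int_part y)%Z) by (apply lt_IZR; lra).
  assert (E : INR (Z.to_nat (Int_part y)) = IZR (Int_part y))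
    by (rewrite INR_IZR_INZ, Z2Nat.id; [reflexivity | lia]).
  rewrite E; split.
  - apply IZR_le; lia.
  - rewrite <- Hy; apply Rmult_le_compat_r; lra.
Qed.

Lemma space_step_pos (ts xs : R) (N : nat) :
  0 < ts -> 0 < xs -> INR N * xs >= ts -> 0 < space_step ts xs N.
Proof.
  intros Hts Hxs HN.
  destruct (grid_M_bounds ts xs N Hts HN).
  apply Rdiv_lt_0_compat; lra.
Qed.

(** Here [lambda = N * xs / (M * ts)], and [M] was rounded down from [N * xs / ts]. *)
Lemma grid_lambda_ge_1 (ts xs : R) (N : nat) :
  0 < ts -> INR N * xs >= ts -> 1 <= grid_lambda ts xs N.
Proof.
  intros Hts HN.
  destruct (grid_M_bounds ts xs N Hts HN) as [HM HMN].
  assert (Hn : INR N <> 0) by (intros E; rewrite E in HN; lra).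
  unfold grid_lambda, space_step, time_step.
  apply Rmult_le_reg_r with (INR (grid_M ts xs N) * ts); [nra|].
  replace (_ / _ * _) with (INR N * xs) by (field; lra).
  lra.
Qed.

Lemma node_nonneg (ts xs : R) (N j : nat) :
  0 < space_step ts xs N -> (1 <= j)%nat -> 0 <= node ts xs N j.
Proof.
  intros Hd Hj; apply le_INR in Hj; simpl in Hj.
  apply Rmult_le_pos; lra.
Qed.

Lemma node_succ (ts xs : R) (N j : nat) :
  node ts xs N (j + 1) = node ts xs N j + space_step ts xs N.
Proof. unfold node; rewrite plus_INR; simpl; ring. Qed.

Lemma grid_x_nonneg (ts xs : R) (N n j : nat) :
  0 < space_step ts xs N -> (1 <= j)%nat -> 0 <= grid_x ts xs N n j.
Proof.
  intros Hd Hj; assert (H := node_nonneg ts xs N j Hd Hj).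
  unfold grid_x; rewrite node_succ; destruct (Nat.odd n); lra.
Qed.

(** The initial data are controlled only for positive arguments; level 1 uses cell midpoints, so
    even [j = 1] avoids the origin. *)
Lemma grid_x_1_pos (ts xs : R) (N j : nat) :
  0 < space_step ts xs N -> (1 <= j)%nat -> 0 < grid_x ts xs N 1 j.
Proof.
  intros Hd Hj; assert (H := node_nonneg ts xs N j Hd Hj).
  unfold grid_x; rewrite node_succ; simpl; lra.
Qed.

(** * Propagation through the time levels *)

Lemma scheme_step_state (ts xs : R) (N n : nat) (u : nat -> R * R) (j : nat) :
  0 < space_step ts xs N ->
  Euler_preserves_states (space_step ts xs N) (grid_lambda ts xs N) ->
  (forall i, (1 <= i <= if Nat.odd n then j else j + 1)%nat ->
     state (fst (u i)) (snd (u i))) ->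
  (1 <= j)%nat ->
  state (fst (scheme_step ts xs N n u j)) (snd (scheme_step ts xs N n u j)).
Proof.
  intros Hd HE Hu Hj.
  assert (Hx := grid_x_nonneg ts xs N (n + 1) j Hd Hj).
  unfold scheme_step; cbv zeta.
  destruct (Nat.odd n); [destruct (Nat.eqb_spec j 1)|]; apply HE;
    try assumption; try apply Hu; try lia.
  - lra.
  (* At the axis the left state is the mirror image of the right one. *)
  - apply state_opp, Hu; lia.
Qed.

Lemma scheme_state (ts xs : R) (N : nat) (a0 b0 : R -> R) (n j : nat) :
  0 < space_step ts xs N ->
  Euler_preserves_states (space_step ts xs N) (grid_lambda ts xs N) ->
  (forall x, 0 < x -> state (a0 x) (b0 x)) ->
  on_grid ts xs N n j ->
  state (scheme_a ts xs N a0 b0 n j) (scheme_b ts xs N a0 b0 n j).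
Proof.
  intros Hd HE H0; revert j.
  induction n as [|n IH]; intros j [Hn Hj]; [lia|].
  destruct n as [|n]; [apply H0, grid_x_1_pos; lia || assumption|].
  apply (scheme_step_state ts xs N (S n)); try assumption; [|lia].
  intros i Hi; apply IH; split; [lia|].
  replace (S (S n) - 1)%nat with (S n) in Hj by lia.
  replace (S n - 1)%nat with n by lia.
  (* A step from an odd level reads no index above [j]. A step from an even level reads [j + 1],
     which fits because exactly there the index range shrinks by one. *)
  destruct (Nat.odd (S n)) eqn:Eo.
  - assert (n / 2 <= S n / 2)%nat by (apply Nat.Div0.div_le_mono; lia). lia.
  - assert (Ev : Nat.Even (S n))
      by (apply Nat.even_spec; now rewrite <- Nat.negb_odd, Eo).
    destruct Ev as [k Ek].
    assert (S n / 2 = k)%nat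
      by (rewrite Ek, Nat.mul_comm; apply Nat.div_mul; lia).
    assert (n / 2 = k - 1)%nat
      by (symmetry; apply (Nat.div_unique n 2 (k - 1) 1); lia).
    lia.
Qed.

Theorem theorem4p6 (ts xs : R) (N : nat) (a0 b0 : R -> R)
  (hts : 0 < ts) (hxs : 0 < xs) (hN : INR N * xs >= ts)
  (h0 : forall x : R, 0 < x -> Rabs (b0 x) < a0 x) :
  scheme_stable ts xs N a0 b0 /\
  (forall n j : nat, on_grid ts xs N n j ->
     0 < pressure (scheme_a ts xs N a0 b0 n j) (scheme_b ts xs N a0 b0 n j)).
Proof.
  assert (Hd := space_step_pos ts xs N hts hxs hN).
  assert (HE := Euler_preserves_states_of_lambda _ _ Hd
                  (grid_lambda_ge_1 ts xs N hts hN)).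
  assert (HS := fun n j => scheme_state ts xs N a0 b0 n j Hd HE h0).
  split; [split; assumption|].
  intros n j Hg; apply pressure_pos, HS, Hg.
Qed.
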